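(* If $(U,S)$ is an action pair in a monoid $M$, and if $U$ and $S$ are both submonoids of $M$, then with the notation of the context, the monoid $US$ has presentation $$\operatorname{Mon}\langle X_U\cup X_S : R_U\cup R_S\cup R_1\cup R_2\cup R_3\rangle$$ via the morphism $\Phi:(X_U\cup X_S)^*\to US$ determined by $x\mapsto x\phi_U$ for $x\in X_U$ and $x\mapsto x\phi_S$ for $x\in X_S$, where $$R_1=\{(xy,\,{}^xy\cdot x):x\in X_S,\ y\in X_U\},$$ $$R_2=\{(N_U(u)N_S(s),\,N_U(u)N_S(t)):u\in U,\ (s,t)\in\Omega_u\},$$ $$R_3=\{(x,\,x^+x):x\in X_S,\ \overline x^+\neq1\},$$ with ${}^xy=N_U({}^{\overline x}\,\overline y)\in X_U^*$ and $x^+=N_U(\overline x^+)\in X_U^*$ for $x\in X_S$, $y\in X_U$.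
   Context: Action pairs. For a monoid $M$ with identity $1$ and a subsemigroup $U$, $U^1=U\cup\{1\}$. An action pair in $M$ is a pair $(U,S)$ of subsemigroups of $M$ with a left action $(s,u)\mapsto{}^su$ of $S$ on $U^1$ by semigroup morphisms (${}^s({}^tu)={}^{st}u$ and ${}^s(uv)={}^su\cdot{}^sv$) such that (A1) $s\cdot u={}^su\cdot s$ for all $s\in S$, $u\in U^1$, and (A2) $us=vt\Rightarrow u\cdot{}^s1=v\cdot{}^t1$ for all $u,v\in U^1$, $s,t\in S$. Write $s^+={}^s1$ for $s\in S$. $US=\{us:u\in U,s\in S\}$. For $u\in U$ let $\theta_u=\{(s,t)\in S\times S:us=ut\}$, a right congruence on $S$, and let $\Omega_u\subseteq S\times S$ be a fixed set of pairs generating $\theta_u$ as a right congruence. Presentations. $X^*$ is the free monoid on $X$, with empty word $\iota$; for $R\subseteq X^*\times X^*$, $R^\sharp$ is the congruence generated by $R$. A monoid $T$ has presentation $\operatorname{Mon}\langle X:R\rangle$ via $\phi$ if $\phi:X^*\to T$ is a surjective monoid morphism with kernel $R^\sharp$. A normal form function is a map $N:T\to X^*$ with $N(t)\phi=t$ for all $t\in T$. Maps are written on the right. Fixed data. $U$ has presentation $\operatorname{Mon}\langle X_U:R_U\rangle$ via $\phi_U:X_U^*\to U$, and $S$ has presentation $\operatorname{Mon}\langle X_S:R_S\rangle$ via $\phi_S:X_S^*\to S$, where $X_U\cap X_S=\varnothing$, no letter of $X_U$ or $X_S$ maps to $1$, and $\phi_U|_{X_U}$, $\phi_S|_{X_S}$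 are injective. Write $\overline w=w\phi_U$ for $w\in X_U^*$ and $\overline w=w\phi_S$ for $w\in X_S^*$. $N_U:U\to X_U^*$ and $N_S:S\to X_S^*$ are fixed normal form functions with $N_U(1)=N_S(1)=\iota$, $N_U(\overline x)=x$ for $x\in X_U$, and $N_S(\overline y)=y$ for $y\in X_S$. *)

(* Defs.v *)
From mathcomp Require Import all_boot.
From mathcomp Require Import boolp classical_sets.

Set Implicit Arguments.
Unset Strict Implicit.
Unset Printing Implicit Defensive.

Local Open Scope classical_set_scope.
Local Open Scope group_scope.

(* Subsets of a monoid are [set M], binary relations are sets of pairs, and
   the free monoid on X is [seq X] under [++].  Since every type carries a
   choice operator classically, [monoidType] covers all monoids. *)

Section Subsemigroups.
Variable M : monoidType.
Implicit Types U S : set M.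

Definition subsemigroup U := forall u v, U u -> U v -> U (u * v).

Definition submonoid U := U 1 /\ subsemigroup U.

Definition adjoin1 U : set M := U `|` [set 1].

Definition setmulg U S : set M := [set u * s | u in U & s in S].

End Subsemigroups.

Section Presentations.
Variable X : Type.
Implicit Types (u v w : seq X) (C R : set (seq X * seq X)).

Definition congruence C :=
  [/\ forall w, C (w, w),
      forall v w, C (v, w) -> C (w, v),
      forall u v w, C (u, v) -> C (v, w) -> C (u, w)
    & forall a b v w, C (v, w) -> C (a ++ v ++ b, a ++ w ++ b)].

Definition cong_gen R : set (seq X * seq X) := smallest congruence R.

Variable M : monoidType.

Definition word_morphism (phi : seq X -> M) :=
  phi [::] = 1 /\ forall v w, phi (v ++ w) = phi v * phi w.

Definition word_lift (f : X -> M) : seq X -> M := fun w => \prod_(x <- w) f x.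

Definition word_kernel (phi : seq X -> M) : set (seq X * seq X) :=
  [set p | phi p.1 = phi p.2].

(* The submonoid T of M has presentation Mon<X : R> via phi. *)
Definition has_presentation (T : set M) R (phi : seq X -> M) :=
  [/\ submonoid T, word_morphism phi, range phi = T
    & word_kernel phi = cong_gen R].

(* Only the values of N on T matter. *)
Definition normal_form (T : set M) (phi : seq X -> M) (N : M -> seq X) :=
  forall t, T t -> phi (N t) = t.

End Presentations.

Section ActionPairs.
Variable M : monoidType.
Implicit Types (U S : set M) (act : M -> M -> M).

(* [act s u] is the element written {}^s u; only its values for s in S and
   u in U^1 matter. *)
Definition semigroup_action U S act :=
  [/\ forall s u, S s -> adjoin1 U u -> adjoin1 U (act s u),
      forall s t u, S s -> S t -> adjoin1 U u ->
        act s (act t u) = act (s * t) u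
    & forall s u v, S s -> adjoin1 U u -> adjoin1 U v ->
        act s (u * v) = act s u * act s v].

Definition action_pair U S act :=
  [/\ subsemigroup U, subsemigroup S, semigroup_action U S act,
      forall s u, S s -> adjoin1 U u -> s * u = act s u * s
    & forall u v s t, adjoin1 U u -> adjoin1 U v -> S s -> S t ->
        u * s = v * t -> u * act s 1 = v * act t 1].

Definition theta S (u : M) : set (M * M) :=
  [set p | [/\ S p.1, S p.2 & u * p.1 = u * p.2]].

Definition right_congruence S (C : set (M * M)) :=
  [/\ C `<=` S `*` S,
      forall s, S s -> C (s, s),
      forall s t, C (s, t) -> C (t, s),
      forall r s t, C (r, s) -> C (s, t) -> C (r, t)
    & forall a s t, S a -> C (s, t) -> C (s * a, t * a)].

Definition right_cong_gen S (O : set (M * M)) : set (M * M) :=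
  smallest (right_congruence S) O.

End ActionPairs.

(* The disjoint union of the alphabets XU and XS is the sum type XU + XS. *)
Section Relations.
Variables (M : monoidType) (XU XS : Type).
Variables (U : set M) (act : M -> M -> M) (Omega : M -> set (M * M)).
Variables (phiU : seq XU -> M) (phiS : seq XS -> M).
Variables (NU : M -> seq XU) (NS : M -> seq XS).

Definition wordU (w : seq XU) : seq (XU + XS) := map inl w.
Definition wordS (w : seq XS) : seq (XU + XS) := map inr w.

Definition embU (R : set (seq XU * seq XU)) :
    set (seq (XU + XS) * seq (XU + XS)) :=
  [set (wordU p.1, wordU p.2) | p in R].

Definition embS (R : set (seq XS * seq XS)) :
    set (seq (XU + XS) * seq (XU + XS)) :=
  [set (wordS p.1, wordS p.2) | p in R].

Definition R1 : set (seq (XU + XS) * seq (XU + XS)) :=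
  [set p | exists (x : XS) (y : XU),
     p = ([:: inr x; inl y],
          wordU (NU (act (phiS [:: x]) (phiU [:: y]))) ++ [:: inr x])].

Definition R2 : set (seq (XU + XS) * seq (XU + XS)) :=
  [set p | exists u s t, [/\ U u, Omega u (s, t) &
     p = (wordU (NU u) ++ wordS (NS s), wordU (NU u) ++ wordS (NS t))]].

Definition R3 : set (seq (XU + XS) * seq (XU + XS)) :=
  [set p | exists x : XS, act (phiS [:: x]) 1 <> 1 /\
     p = ([:: inr x], wordU (NU (act (phiS [:: x]) 1)) ++ [:: inr x])].

Definition Phi : seq (XU + XS) -> M :=
  word_lift (fun z => match z with
                      | inl x => phiU [:: x]
                      | inr x => phiS [:: x]
                      end).

End Relations.

Arguments embU {XU XS} R.
Arguments embS {XU XS} R.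
Arguments R1 {M XU XS} act phiU phiS NU.
Arguments R2 {M XU XS} U Omega NU NS.
Arguments R3 {M XU XS} act phiS NU.

(* Main.v *)
Require Import Defs.
From mathcomp Require Import all_boot.
From mathcomp Require Import boolp classical_sets.

Local Open Scope classical_set_scope.
Local Open Scope group_scope.

(** By (A1) a letter of S can be moved to the right past a word over [XU] at
    the price of acting on that word; the relations R1 do this letter by
    letter, and R3 covers the empty word, where the price [s^+] may be
    nontrivial ([act_letter], and [act_word] for words over [XS]).
    Hence every word is equivalent to some [NU u ++ NS s]
    ([normal_word_exists]).

    It remains to see that [u * s = v * t] forces
    [NU u ++ NS s ~ NU v ++ NS t].  Since [s ~ NU s^+ ++ s], the first word is
    equivalent to [NU (u * s^+) ++ NS s] and the second to
    [NU (v * t^+) ++ NS t] ([normal_word_plus]).  By (A2) both now begin with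
    the same element [p := u * s^+ = v * t^+] of U, and [p * s = p * t], that is
    [(s, t)] lies in [theta S p].  Finally, the pairs [(s, t)] with
    [NU p ++ NS s ~ NU p ++ NS t] form a right congruence which contains
    [Omega p] by R2, so it contains the whole of [theta S p]
    ([theta_normal_word]). *)

(** * Congruences on free monoids *)

Section Congruences.
Context {X : Type}.
Implicit Types (C R : set (seq X * seq X)) (v w : seq X).

Lemma cong_gen_congruence R : congruence (cong_gen R).
Proof.
split.
- by move=> w C [[Cr _ _ _] _]; apply: Cr.
- by move=> v w vw C CR; case: (CR) => -[_ Cs _ _] _; exact: Cs (vw _ CR).
- move=> u v w uv vw C CR; case: (CR) => -[_ _ Ct _] _.
  exact: Ct (uv _ CR) (vw _ CR).
- by move=> a b v w vw C CR; case: (CR) => -[_ _ _ Cm] _; exact: Cm (vw _ CR).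
Qed.

Lemma cong_cat C v v' w w' : congruence C ->
  C (v, v') -> C (w, w') -> C (v ++ w, v' ++ w').
Proof.
move=> [_ _ Ct Cm] vv' ww'; apply: (Ct _ (v' ++ w)).
  exact: (Cm [::] w).
by have := Cm v' [::] _ _ ww'; rewrite !cats0.
Qed.

Lemma congruence_kernel (M : monoidType) (phi : seq X -> M) :
  word_morphism phi -> congruence (word_kernel phi).
Proof.
rewrite /word_kernel; case=> _ phiM; split=> //=.
- by move=> u v w -> ->.
- by move=> a b v w vw; rewrite !phiM vw.
Qed.

Lemma word_morphism_lift (M : monoidType) (f : X -> M) :
  word_morphism (word_lift f).
Proof.
by rewrite /word_lift; split=> [|v w]; rewrite ?big_nil ?big_cat.
Qed.

Lemma word_lift_letters {M : monoidType} {phi : seq X -> M} :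
  word_morphism phi -> word_lift (fun x => phi [:: x]) =1 phi.
Proof.
case=> phi1 phiM; rewrite /word_lift.
by elim=> [|x w IH]; rewrite ?big_nil // big_cons IH -phiM.
Qed.

End Congruences.

Lemma cong_gen_map {X Y : Type} (f : X -> Y) R (C : set (seq Y * seq Y)) :
  congruence C -> (forall p, R p -> C (map f p.1, map f p.2)) ->
  forall v w, cong_gen R (v, w) -> C (map f v, map f w).
Proof.
move=> [Cr Cs Ct Cm] RC v w.
apply: (@smallest_sub _ _ _ [set p | C (map f p.1, map f p.2)]) => //; split=> /=.
- by move=> ?; apply: Cr.
- by move=> ? ?; apply: Cs.
- by move=> ? ? ?; apply: Ct.
- by move=> a b ? ? ?; rewrite !map_cat; apply: Cm.
Qed.

(** * Words over the two alphabets *)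

Section Presentation.
Context {M : monoidType} {U S : set M} {act : M -> M -> M}.
Context {Omega : M -> set (M * M)} {XU XS : Type}.
Context {RU : set (seq XU * seq XU)} {RS : set (seq XS * seq XS)}.
Context {phiU : seq XU -> M} {phiS : seq XS -> M}.
Context {NU : M -> seq XU} {NS : M -> seq XS}.
Hypotheses (USact : action_pair U S act).
Hypotheses (Usub : submonoid U) (Ssub : submonoid S).
Hypothesis Omega_gen : forall u, U u -> right_cong_gen S (Omega u) = theta S u.
Hypotheses (presU : has_presentation U RU phiU).
Hypotheses (presS : has_presentation S RS phiS).
Hypotheses (NU_nf : normal_form U phiU NU) (NS_nf : normal_form S phiS NS).
Hypothesis NU1 : NU 1 = [::].

Notation rels := (embU RU `|` embS RS `|` R1 act phiU phiS NU
       `|` R2 U Omega NU NS `|` R3 act phiS NU).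
Notation "v ~~ w" := (cong_gen rels (v, w)) (at level 70).
Notation wU := (@wordU XU XS).
Notation wS := (@wordS XU XS).
Notation PhiUS := (Phi phiU phiS).

Let U1 : U 1. Proof. by case: Usub. Qed.
Let UM u v : U u -> U v -> U (u * v). Proof. by case: Usub => _; apply. Qed.
Let S1 : S 1. Proof. by case: Ssub. Qed.
Let SM s t : S s -> S t -> S (s * t). Proof. by case: Ssub => _; apply. Qed.

Let adjU u : U u -> adjoin1 U u. Proof. by left. Qed.

Let actU {s u} : S s -> U u -> U (act s u).
Proof.
case: USact => _ _ [aU _ _] _ _ Ss /adjU Uu.
by case: (aU s u Ss Uu) => // ->.
Qed.

Let actA s t u : S s -> S t -> U u -> act s (act t u) = act (s * t) u.
Proof. by case: USact => _ _ [_ aA _] _ _ Ss St /adjU; apply: aA. Qed.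

Let actM s u v : S s -> U u -> U v -> act s (u * v) = act s u * act s v.
Proof. by case: USact => _ _ [_ _ aM] _ _ Ss /adjU Uu /adjU; apply: aM. Qed.

Let act_comm s u : S s -> U u -> s * u = act s u * s.
Proof. by case: USact => _ _ _ aC _ Ss /adjU; apply: aC. Qed.

Let act_plus u v s t : U u -> U v -> S s -> S t ->
  u * s = v * t -> u * act s 1 = v * act t 1.
Proof. by case: USact => _ _ _ _ aP /adjU Uu /adjU Uv; apply: aP. Qed.

(** Unitality of the action is not an axiom: it is (A1) for [s = 1]. *)
Let act1 u : U u -> act 1 u = u.
Proof. by move=> Uu; have := act_comm 1 u S1 Uu; rewrite mul1g mulg1. Qed.

Let plus_mul s : S s -> act s 1 * s = s.
Proof. by move=> Ss; rewrite -act_comm // mulg1. Qed.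

Let phiU_morph : word_morphism phiU. Proof. by case: presU. Qed.
Let phiS_morph : word_morphism phiS. Proof. by case: presS. Qed.
Let phiU_in w : U (phiU w).
Proof. by case: presU => _ _ <- _; exists w. Qed.
Let phiS_in w : S (phiS w).
Proof. by case: presS => _ _ <- _; exists w. Qed.

Let eqvC : congruence (cong_gen rels). Proof. exact: cong_gen_congruence. Qed.
Let eqv_refl w : w ~~ w. Proof. by case: eqvC. Qed.
Let eqv_sym v w : v ~~ w -> w ~~ v. Proof. by case: eqvC => _ h _ _; apply: h. Qed.
Let eqv_trans v u w : u ~~ v -> v ~~ w -> u ~~ w.
Proof. by case: eqvC => _ _ h _; apply: h. Qed.
Let eqv_cat v v' w w' : v ~~ v' -> w ~~ w' -> v ++ w ~~ v' ++ w'.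
Proof. exact: cong_cat. Qed.

Lemma wordU_eqv v w : phiU v = phiU w -> wU v ~~ wU w.
Proof.
case: presU => _ _ _ kerU vw.
apply: (cong_gen_map _ RU) => //.
  by move=> p Rp; apply: sub_gen_smallest; do 4 left; exists p.
by rewrite -kerU.
Qed.

Lemma wordS_eqv v w : phiS v = phiS w -> wS v ~~ wS w.
Proof.
case: presS => _ _ _ kerS vw.
apply: (cong_gen_map _ RS) => //.
  by move=> p Rp; apply: sub_gen_smallest; do 3 left; right; exists p.
by rewrite -kerS.
Qed.

Lemma NU_phiU w : wU w ~~ wU (NU (phiU w)).
Proof. by apply: wordU_eqv; rewrite NU_nf. Qed.

Lemma NS_phiS w : wS w ~~ wS (NS (phiS w)).
Proof. by apply: wordS_eqv; rewrite NS_nf. Qed.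

Lemma NU_mul u v : U u -> U v -> wU (NU u) ++ wU (NU v) ~~ wU (NU (u * v)).
Proof.
move=> Uu Uv; rewrite /wordU -map_cat; apply: wordU_eqv.
by case: phiU_morph => _ ->; rewrite !NU_nf //; apply: UM.
Qed.

Lemma NS_mul s t : S s -> S t -> wS (NS s) ++ wS (NS t) ~~ wS (NS (s * t)).
Proof.
move=> Ss St; rewrite /wordS -map_cat; apply: wordS_eqv.
by case: phiS_morph => _ ->; rewrite !NS_nf //; apply: SM.
Qed.

(** * Reduction to normal words *)

(** For one letter of S, peeling off the letters of [w] by R1 leaves the case
    of the empty word, which is R3. *)
Lemma act_letter x w :
  inr x :: wU w ~~ wU (NU (act (phiS [:: x]) (phiU w))) ++ [:: inr x].
Proof.
have Sx := phiS_in [:: x].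
elim: w => [|y w IH].
  case: phiU_morph => -> _.
  have [->|x1] := pselect (act (phiS [:: x]) 1 = 1); first by rewrite NU1.
  by apply: sub_gen_smallest; right; exists x.
have -> : phiU (y :: w) = phiU [:: y] * phiU w by case: phiU_morph => _ <-.
rewrite actM //.
apply: (eqv_trans (wU (NU (act (phiS [:: x]) (phiU [:: y])))
                      ++ inr x :: wU w)).
  rewrite -cat_rcons -cats1.
  apply: (eqv_cat [:: inr x; inl y] _ (wU w)) => //.
  by apply: sub_gen_smallest; do 2 left; right; exists x, y.
apply: eqv_trans (eqv_cat _ _ _ _ (eqv_refl _) IH) _.
by rewrite catA; apply: eqv_cat => //; apply: NU_mul; apply: actU.
Qed.

Lemma act_word v w :
  wS v ++ wU w ~~ wU (NU (act (phiS v) (phiU w))) ++ wS v.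
Proof.
elim: v => [|x v IH] /=.
  by case: phiS_morph => -> _; rewrite act1 // cats0; apply: NU_phiU.
have -> : phiS (x :: v) = phiS [:: x] * phiS v by case: phiS_morph => _ <-.
rewrite -actA //.
apply: eqv_trans (eqv_cat [:: inr x] _ _ _ (eqv_refl _) IH) _.
have := act_letter x (NU (act (phiS v) (phiU w))).
rewrite NU_nf; last exact: actU.
by move=> /(eqv_cat _ _ (wS v) (wS v)) /(_ (eqv_refl _)); rewrite -catA.
Qed.

Definition normal_word (u s : M) : seq (XU + XS) := wU (NU u) ++ wS (NS s).

Lemma Phi_wordU w : PhiUS (wU w) = phiU w.
Proof.
by rewrite -(word_lift_letters phiU_morph) /Phi /word_lift big_map.
Qed.

Lemma Phi_wordS w : PhiUS (wS w) = phiS w.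
Proof.
by rewrite -(word_lift_letters phiS_morph) /Phi /word_lift big_map.
Qed.

Lemma Phi_cat v w : PhiUS (v ++ w) = PhiUS v * PhiUS w.
Proof. exact: (proj2 (word_morphism_lift _ _)). Qed.

Lemma Phi_normal_word u s : U u -> S s -> PhiUS (normal_word u s) = u * s.
Proof.
by move=> Uu Ss; rewrite Phi_cat Phi_wordU Phi_wordS NU_nf // NS_nf.
Qed.

Lemma normal_word_exists w :
  exists u s, [/\ U u, S s & w ~~ normal_word u s].
Proof.
elim: w => [|[x|x] w [u [s [Uu Ss IH]]]].
- exists 1, 1; split=> //; rewrite /normal_word NU1 /=.
  have := NS_phiS [::].
  by case: phiS_morph => -> _.
- exists (phiU [:: x] * u), s; split=> //; first exact: UM.
  apply: eqv_trans (eqv_cat [:: inl x] _ _ _ (NU_phiU [:: x]) IH) _.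
  by rewrite catA; apply: eqv_cat => //; apply: NU_mul.
- exists (act (phiS [:: x]) u), (phiS [:: x] * s).
  split; [exact: actU | exact: SM |].
  apply: eqv_trans (eqv_cat [:: inr x] _ _ _ (eqv_refl _) IH) _.
  have := act_letter x (NU u); rewrite NU_nf // => xu.
  apply: eqv_trans (eqv_cat _ _ (wS (NS s)) _ xu (eqv_refl _)) _.
  rewrite -catA; apply: eqv_cat => //.
  apply: eqv_trans (NS_mul _ _ (phiS_in [:: x]) Ss).
  by apply: eqv_cat => //; apply: (NS_phiS [:: x]).
Qed.

(** * Equivalence of normal words *)

(** This is [act_word] for the empty word over [XU], which inserts [s^+]. *)
Lemma normal_word_plus u s : U u -> S s ->
  normal_word u s ~~ normal_word (u * act s 1) s.
Proof.
move=> Uu Ss; have := act_word (NS s) [::].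
rewrite cats0 NS_nf //; case: phiU_morph => -> _ ss.
apply: eqv_trans (eqv_cat _ _ _ _ (eqv_refl _) ss) _.
by rewrite catA; apply: eqv_cat => //; apply: NU_mul => //; apply: actU.
Qed.

Lemma right_congruence_normal_word p :
  right_congruence S
    [set q | [/\ S q.1, S q.2 & normal_word p q.1 ~~ normal_word p q.2]].
Proof.
split=> /=.
- by move=> q [].
- by move=> s Ss; split.
- by move=> s t [? ? ?]; split=> //; apply: eqv_sym.
- by move=> r s t [? ? rs] [? ? st]; split=> //; apply: eqv_trans rs st.
move=> a s t Sa [Ss St st]; split; try exact: SM.
have mul r : S r -> normal_word p r ++ wS (NS a) ~~ normal_word p (r * a).
  by move=> Sr; rewrite -catA; apply: eqv_cat => //; apply: NS_mul.
apply: eqv_trans (eqv_sym _ _ (mul s Ss)) (eqv_trans _ _ _ _ (mul t St)).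
exact: eqv_cat.
Qed.

Lemma sub_theta u : U u -> Omega u `<=` theta S u.
Proof. by move=> Uu; rewrite -Omega_gen //; apply: sub_gen_smallest. Qed.

Lemma theta_normal_word p s t : U p -> theta S p (s, t) ->
  normal_word p s ~~ normal_word p t.
Proof.
move=> Up; rewrite -Omega_gen //.
case/(_ _ (conj (right_congruence_normal_word p) _)) => // -[a b] Oab.
have [/= Sa Sb _] := sub_theta _ Up _ Oab; split=> //=.
by apply: sub_gen_smallest; left; right; exists p, a, b.
Qed.

Lemma normal_word_eqv u v s t : U u -> U v -> S s -> S t ->
  u * s = v * t -> normal_word u s ~~ normal_word v t.
Proof.
move=> Uu Uv Ss St ust; have usP := act_plus _ _ _ _ Uu Uv Ss St ust.
apply: eqv_trans (normal_word_plus _ _ Uu Ss) _.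
apply: eqv_trans (eqv_sym _ _ (normal_word_plus _ _ Uv St)).
rewrite -usP; apply: theta_normal_word; first by apply: UM => //; apply: actU.
by split=> //=; rewrite {2}usP -!mulgA !plus_mul.
Qed.

(** * Kernel and image of Phi *)

Lemma Phi_rels : rels `<=` word_kernel PhiUS.
Proof.
rewrite /word_kernel => p [[[[[q Rq <-]|[q Rq <-]]|[x [y ->]]]|
  [u [s [t [Uu Ost ->]]]]]|[x [_ ->]]] /=.
- rewrite !Phi_wordU; case: presU => _ _ _ kerU.
  have : cong_gen RU q by apply: sub_gen_smallest.
  by rewrite -kerU.
- rewrite !Phi_wordS; case: presS => _ _ _ kerS.
  have : cong_gen RS q by apply: sub_gen_smallest.
  by rewrite -kerS.
- have Sx := phiS_in [:: x]; have Uy := phiU_in [:: y].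
  rewrite Phi_cat Phi_wordU (Phi_cat [:: inr x] [:: inl y]).
  rewrite (Phi_wordS [:: x]) (Phi_wordU [:: y]) NU_nf; last exact: actU.
  exact: act_comm.
- have [/= Ss St st] := sub_theta _ Uu _ Ost.
  by rewrite !Phi_normal_word.
- have Sx := phiS_in [:: x].
  rewrite Phi_cat Phi_wordU (Phi_wordS [:: x]) NU_nf; last exact: actU.
  by rewrite plus_mul.
Qed.

Lemma kernel_Phi : word_kernel PhiUS = cong_gen rels.
Proof.
have sub : cong_gen rels `<=` word_kernel PhiUS.
  apply: smallest_sub Phi_rels.
  exact/congruence_kernel/word_morphism_lift.
apply/seteqP; split=> // -[v w] /= vw.
have [u [s [Uu Ss vus]]] := normal_word_exists v.
have [u' [s' [Uu' Ss' wus]]] := normal_word_exists w.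
apply: (eqv_trans _ _ _ vus (eqv_trans _ _ _ _ (eqv_sym _ _ wus))).
apply: normal_word_eqv => //.
rewrite -!Phi_normal_word //.
by have := sub _ vus; have := sub _ wus; rewrite /word_kernel /= => <- <-.
Qed.

Lemma range_Phi : range PhiUS = setmulg U S.
Proof.
apply/seteqP; split=> m.
  case=> w _ <-; have [u [s [Uu Ss]]] := normal_word_exists w.
  rewrite -kernel_Phi /word_kernel /= => ->; rewrite Phi_normal_word //.
  by exists u => //; exists s.
case=> u Uu [s Ss <-]; exists (normal_word u s) => //.
exact: Phi_normal_word.
Qed.

Lemma submonoid_setmulg : submonoid (setmulg U S).
Proof.
split; first by exists 1 => //; exists 1 => //; rewrite mulg1.
move=> _ _ [u Uu [s Ss <-]] [v Uv [t St <-]].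
exists (u * act s v); first by apply: UM => //; apply: actU.
exists (s * t); first exact: SM.
by rewrite -!mulgA [s * (v * t)]mulgA (act_comm s v) // !mulgA.
Qed.

End Presentation.

Theorem theorem6p13 (M : monoidType) (U S : set M) (act : M -> M -> M)
  (Omega : M -> set (M * M))
  (XU XS : Type)
  (RU : set (seq XU * seq XU)) (RS : set (seq XS * seq XS))
  (phiU : seq XU -> M) (phiS : seq XS -> M)
  (NU : M -> seq XU) (NS : M -> seq XS)
  (USact : action_pair U S act)
  (Usub : submonoid U) (Ssub : submonoid S)
  (OmegaS : forall u, U u -> Omega u `<=` S `*` S)
  (Omega_gen : forall u, U u -> right_cong_gen S (Omega u) = theta S u)
  (presU : has_presentation U RU phiU)
  (presS : has_presentation S RS phiS)
  (phiU_neq1 : forall x, phiU [:: x] <> 1)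
  (phiS_neq1 : forall x, phiS [:: x] <> 1)
  (phiU_inj : injective (fun x => phiU [:: x]))
  (phiS_inj : injective (fun x => phiS [:: x]))
  (NU_nf : normal_form U phiU NU) (NS_nf : normal_form S phiS NS)
  (NU1 : NU 1 = [::]) (NS1 : NS 1 = [::])
  (NU_letter : forall x, NU (phiU [:: x]) = [:: x])
  (NS_letter : forall y, NS (phiS [:: y]) = [:: y]) :
  has_presentation (setmulg U S)
    (embU RU `|` embS RS `|` R1 act phiU phiS NU
       `|` R2 U Omega NU NS `|` R3 act phiS NU)
    (Phi phiU phiS).
Proof.
split.
- exact: submonoid_setmulg USact Usub Ssub.
- exact: word_morphism_lift.
- exact: range_Phi USact Usub Ssub Omega_gen presU presS NU_nf NS_nf NU1.
- exact: kernel_Phi USact Usub Ssub Omega_gen presU presS NU_nf NS_nf NU1.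
Qed.
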